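(* For every non-integer real number $q>0$ and every integer $n\ge \lceil q\rceil+2$, \[ |\mathsf{S}_n(q)| \;\ge\; 2^{(n-\lceil q\rceil-2)/2}. \]
   Context: For a finite graph $G$, $P_G(x)$ denotes its chromatic polynomial. For a real number $q$ and integer $n\ge1$, $\mathsf{S}_n(q)\coloneqq\{P_G(q): G \text{ a simple graph on } n \text{ vertices}\}$, the set of distinct values of $P_G(q)$ over all $n$-vertex simple graphs. *)

(* Defs.v *)
From HB Require Import structures.
From mathcomp Require Import all_boot all_order all_algebra finmap.
From mathcomp Require Import all_classical all_reals exp.

Set Implicit Arguments.
Unset Strict Implicit.
Unset Printing Implicit Defensive.

Import Order.TTheory GRing.Theory Num.Theory.

Local Open Scope ring_scope.
Local Open Scope classical_set_scope.

Definition simple_graph (T : finType) (e : rel T) : Prop :=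
  symmetric e /\ irreflexive e.

Definition proper_colouring (T C : finType) (e : rel T) (f : {ffun T -> C}) :
  bool := [forall u, forall v, e u v ==> (f u != f v)].

Definition colour_count (T : finType) (e : rel T) (k : nat) : nat :=
  #|[set f : {ffun T -> 'I_k} | proper_colouring e f]%SET|.

Definition is_chromatic_poly (R : realType) (T : finType) (e : rel T)
    (P : {poly R}) : Prop :=
  forall k : nat, P.[k%:R] = (colour_count e k)%:R.

Definition onto_colour_count (T : finType) (e : rel T) (k : nat) : nat :=
  #|[set f : {ffun T -> 'I_k} |
      proper_colouring e f && (f @: [set: T] == [set: 'I_k])%SET]%SET|.

Lemma onto_colour_count_gt (T : finType) (e : rel T) k :
  (#|T| < k)%N -> onto_colour_count e k = 0%N.
Proof.
move=> ltTk; apply: eq_card0 => f; rewrite !inE; apply/negP => /andP[_ /eqP fT].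
have := leq_imset_card f [set: T]%SET.
by rewrite fT !cardsT card_ord leqNgt ltTk.
Qed.

Lemma card_colouring_image (T : finType) (e : rel T) k (A : {set 'I_k}) :
  #|[set f : {ffun T -> 'I_k} |
      proper_colouring e f && (f @: [set: T] == A)%SET]%SET| =
  onto_colour_count e #|A|.
Proof.
pose h (g : {ffun T -> 'I_#|A|}) : {ffun T -> 'I_k} :=
  [ffun x => enum_val (g x)].
have h_inj : injective h.
  move=> g1 g2 /ffunP gE; apply/ffunP => x.
  by have := gE x; rewrite !ffunE => /enum_val_inj.
have h_proper g : proper_colouring e (h g) = proper_colouring e g.
  apply: eq_forallb => u; apply: eq_forallb => v.
  by rewrite !ffunE (inj_eq enum_val_inj).
rewrite /onto_colour_count -(card_imset _ h_inj); apply: eq_card => f.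
rewrite !inE; apply/idP/imsetP => [/andP[fP /eqP fA]|[g + ->]].
  have fin x : f x \in A by rewrite -fA imset_f ?inE.
  pose g : {ffun T -> 'I_#|A|} := [ffun x => enum_rank_in (fin x) (f x)].
  have fE : f = h g.
    by apply/ffunP => x; rewrite !ffunE enum_rankK_in.
  exists g => //; rewrite inE -h_proper -fE fP /=.
  apply/eqP/setP => i; rewrite inE; apply/imsetP.
  have : {subset A <= (f @: [set: T])%SET} by move=> y; rewrite fA.
  move=> /(_ _ (enum_valP i)) /imsetP[x _ xE]; exists x => //.
  by apply: enum_val_inj; rewrite xE fE ffunE.
rewrite inE h_proper => /andP[-> /eqP gT] /=.
apply/eqP/setP => y; apply/imsetP/idP => [[x _ ->]|yA].
  by rewrite ffunE enum_valP.
have : enum_rank_in yA y \in (g @: [set: T])%SET by rewrite gT inE.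
by move=> /imsetP[x _ xE]; exists x => //; rewrite ffunE -xE enum_rankK_in.
Qed.

Lemma colour_countE (T : finType) (e : rel T) k :
  colour_count e k =
  (\sum_(j < #|T|.+1) 'C(k, j) * onto_colour_count e j)%N.
Proof.
rewrite /colour_count -sum1_card.
rewrite (partition_big (fun f : {ffun T -> 'I_k} => f @: [set: T])%SET
  predT) //=.
under eq_bigr => A _.
  have -> : (\sum_(f | (f \in [set f0 | proper_colouring e f0]%SET) &&
      (f @: [set: T] == A)%SET) 1)%N =
      (\sum_(j < #|T|.+1) (#|A| == j) * onto_colour_count e j)%N.
    rewrite sum1_card.
    transitivity (onto_colour_count e #|A|).
      rewrite -card_colouring_image; apply: eq_card => f.
      by rewrite unfold_in /= !inE.
    have [ltTA|leAT] := ltnP #|T| #|A|.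
      rewrite onto_colour_count_gt// big1 // => j _.
      by case: eqP => // jA; have := ltn_ord j; rewrite -jA ltnS leqNgt ltTA.
    have lt_A : (#|A| < #|T|.+1)%N by [].
    rewrite (bigD1 (Ordinal lt_A)) //= eqxx mul1n big1 ?addn0 // => j.
    by rewrite -val_eqE /= eq_sym => /negPf ->.
  over.
rewrite exchange_big /=; apply: eq_bigr => j _.
rewrite -big_distrl /=; congr (_ * _)%N.
have := card_draws 'I_k j; rewrite card_ord => <-.
rewrite -[RHS]sum1_card [RHS]big_mkcond /=.
by apply: eq_bigr => A _; rewrite inE; case: eqP.
Qed.

Lemma horner_falling (R : realType) (k j : nat) :
  (\prod_(i < j) ('X - i%:R%:P) : {poly R}).[k%:R] = (k ^_ j)%:R.
Proof.
elim: j => [|j IHj]; first by rewrite big_ord0 hornerC ffactn0.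
rewrite big_ord_recr hornerM IHj ffactnSr natrM /= hornerXsubC.
have [jk|kj] := leqP j k; first by rewrite natrB.
by rewrite ffact_small // !mul0r.
Qed.

Lemma chromatic_poly_exists (R : realType) (T : finType) (e : rel T) :
  exists P : {poly R}, is_chromatic_poly e P.
Proof.
exists (\sum_(j < #|T|.+1) ((onto_colour_count e j)%:R / (j`!)%:R) *:
          \prod_(i < j) ('X - i%:R%:P)) => k.
rewrite horner_sum colour_countE natr_sum; apply: eq_bigr => j _.
rewrite hornerZ horner_falling -bin_ffact !natrM mulrACA.
by rewrite mulVf ?mulr1 1?mulrC // pnatr_eq0 -lt0n fact_gt0.
Qed.

Lemma chromatic_poly_unique (R : realType) (T : finType) (e : rel T)
    (P Q : {poly R}) :
  is_chromatic_poly e P -> is_chromatic_poly e Q -> P = Q.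
Proof.
move=> hP hQ; apply/eqP; rewrite -subr_eq0; apply/eqP.
pose rs : seq R := [seq i%:R | i <- iota 0 (size (P - Q))].
apply: (@roots_geq_poly_eq0 _ _ rs); last by rewrite size_map size_iota.
- by apply/allP => _ /mapP[i _ ->]; rewrite rootE hornerD hornerN hP hQ subrr.
- rewrite map_inj_uniq ?iota_uniq //.
  by move=> i j /eqP; rewrite eqr_nat => /eqP.
Qed.

Definition chromatic_poly (R : realType) (T : finType) (e : rel T) :
  {poly R} := sval (cid (chromatic_poly_exists R e)).

Lemma chromatic_polyP (R : realType) (T : finType) (e : rel T) :
  is_chromatic_poly e (chromatic_poly R e).
Proof. exact: svalP (cid _). Qed.

(* Labelled graphs on 'I_n suffice: every n-vertex graph is isomorphic to one
   of them, and isomorphic graphs have the same chromatic polynomial. *)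
Definition chromatic_values (R : realType) (n : nat) (q : R) : set R :=
  [set v | exists e : rel 'I_n,
             simple_graph e /\ v = (chromatic_poly R e).[q]].

(* [fset_set] is the empty set on infinite sets; this lemma shows that
   #|` fset_set (chromatic_values n q)| is the genuine cardinality. *)
Lemma finite_chromatic_values (R : realType) (n : nat) (q : R) :
  finite_set (chromatic_values n q).
Proof.
pose F (g : {ffun 'I_n * 'I_n -> bool}) : R :=
  (chromatic_poly R (fun u v => g (u, v))).[q].
apply: (@sub_finite_set _ _ (F @` setT)); last first.
  by apply: finite_image; exact: finite_finset.
move=> _ [e [_ ->]]; exists [ffun p => e p.1 p.2] => //.
rewrite /F; congr (chromatic_poly R _).[q].
by apply/funext => u; apply/funext => v; rewrite ffunE.
Qed.

(* Main.v *)
(* Joining with a clique on [ceil q - 1] vertices reduces to [0 < q < 1], since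
   the cone over G has chromatic polynomial [x * P_G (x - 1)].  For a graph G
   with two marked vertices u, v let A and B count the colourings with
   [f u = f v] and [f u <> f v]; these are the chromatic polynomials of G / uv
   and G + uv.  Two ways to add a vertex act on the pair (A, B), evaluated at q,
   by linear maps.  On [s = - A / B] in (0, 1] they act by injective maps with
   disjoint images, so the [2 ^ l] words of length l give as many ratios of an
   element of [S_(l + 2) (q)] to an element of [S_(l + 3) (q)].  Hence
   [2 ^ l <= |S_(l + 2)| * |S_(l + 3)| <= |S_(l + 3)| ^ 2], the last step because
   an isolated vertex multiplies P_G(q) by q. *)
Require Import Defs.
From mathcomp Require Import all_boot all_order all_algebra finmap.
From mathcomp Require Import all_classical all_reals exp.
From mathcomp Require Import ring lra.

Set Implicit Arguments.
Unset Strict Implicit.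
Unset Printing Implicit Defensive.

Import Order.TTheory GRing.Theory Num.Theory.

Local Open Scope ring_scope.

(** * Colourings of a graph with one added vertex *)

Definition adjoin (T : finType) (e : rel T) (N : pred T) : rel (option T) :=
  fun x y => match x, y with
    | Some a, Some b => e a b
    | None, Some b => N b
    | Some a, None => N a
    | None, None => false
    end.

Definition glue (T C : finType) (g : {ffun T -> C}) (c : C) :
  {ffun option T -> C} := [ffun x => oapp g c x].

Lemma simple_adjoin (T : finType) (e : rel T) (N : pred T) :
  simple_graph e -> simple_graph (adjoin e N).
Proof. by move=> [eS eI]; split=> [[x|] [y|]|[x|]] //=. Qed.

Lemma proper_glue (T C : finType) (e : rel T) (N : pred T)
    (g : {ffun T -> C}) (c : C) :
  proper_colouring (adjoin e N) (glue g c) =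
  proper_colouring e g && [forall x, N x ==> (g x != c)].
Proof.
apply/forallP/andP => [gP|[/forallP gP /forallP NP] [x|]].
- split.
    apply/forallP => x; apply/forallP => y.
    by have /forallP/(_ (Some y)) := gP (Some x); rewrite !ffunE.
  by apply/forallP => x; have /forallP/(_ None) := gP (Some x); rewrite !ffunE.
- by apply/forallP => -[y|]; rewrite !ffunE //=; have /forallP := gP x.
- by apply/forallP => -[y|]; rewrite !ffunE //= eq_sym.
Qed.

Lemma card_glue (T C : finType) (P : pred {ffun option T -> C}) :
  (#|[set F | P F]%SET| = \sum_g #|[set c | P (glue g c)]%SET|)%N.
Proof.
rewrite -sum1_card.
rewrite (reindex (fun p : {ffun T -> C} * C => glue p.1 p.2)) /=; last first.
  exists (fun F : {ffun option T -> C} => ([ffun x => F (Some x)], F None)).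
    move=> [g c] _; rewrite ffunE; congr pair.
    by apply/ffunP => x; rewrite !ffunE.
  by move=> F _; apply/ffunP => -[x|]; rewrite ffunE /= ?ffunE.
under [RHS]eq_bigr do rewrite -sum1_card.
by rewrite pair_big_dep /=; apply: eq_bigl => p; rewrite !inE.
Qed.

Lemma card_adjoin (T C : finType) (e : rel T) (N : pred T)
    (P : pred {ffun option T -> C}) :
  (#|[set F | proper_colouring (adjoin e N) F && P F]%SET| =
  \sum_(g | proper_colouring e g)
    #|[set c | [forall x, N x ==> (g x != c)] && P (glue g c)]%SET|)%N.
Proof.
rewrite card_glue [RHS]big_mkcond; apply: eq_bigr => g _.
case: ifP => eg; last first.
  by apply: eq_card0 => c; rewrite !inE proper_glue eg.
by apply: eq_card => c; rewrite !inE proper_glue eg.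
Qed.

Lemma colour_count_adjoin (T : finType) (e : rel T) (N : pred T) k :
  colour_count (adjoin e N) k =
  (\sum_(g : {ffun T -> 'I_k} | proper_colouring e g)
    #|[set c | [forall x, N x ==> (g x != c)]]%SET|)%N.
Proof.
transitivity #|[set F : {ffun option T -> 'I_k} |
    proper_colouring (adjoin e N) F && true]%SET|.
  by apply: eq_card => F; rewrite !inE andbT.
rewrite card_adjoin; apply: eq_bigr => g _.
by apply: eq_card => c; rewrite !inE andbT.
Qed.

Lemma card_neq1 (R : realType) k (i : 'I_k) :
  #|[set c | i != c]%SET|%:R = k%:R - 1 :> R.
Proof.
have -> : [set c | i != c]%SET = (~: [set i])%SET.
  by apply/setP => c; rewrite !inE eq_sym.
have := cardsC [set i]%SET; rewrite cards1 card_ord.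
move=> /(congr1 (fun m => m%:R : R)) <-.
by rewrite natrD addrAC subrr add0r.
Qed.

Lemma card_neq2 (R : realType) k (i j : 'I_k) : i != j ->
  #|[set c | (i != c) && (j != c)]%SET|%:R = k%:R - 2 :> R.
Proof.
move=> ij; have -> : [set c | (i != c) && (j != c)]%SET = (~: [set i; j])%SET.
  by apply/setP => c; rewrite !inE negb_or ![c == _]eq_sym.
have := cardsC [set i; j]%SET; rewrite cards2 ij card_ord.
move=> /(congr1 (fun m => m%:R : R)) <-.
by rewrite natrD addrAC subrr add0r.
Qed.

Lemma forall_pred1 (T C : finType) (u : T) (g : T -> C) c :
  [forall x, pred1 u x ==> (g x != c)] = (g u != c).
Proof.
apply/forallP/idP => [/(_ u)|gu x]; first by rewrite /= eqxx.
by apply/implyP => /eqP ->.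
Qed.

Lemma forall_pred2 (T C : finType) (u v : T) (g : T -> C) c :
  [forall x, pred2 u v x ==> (g x != c)] = (g u != c) && (g v != c).
Proof.
apply/forallP/andP => [gP|[gu gv] x].
  by split; [have := gP u|have := gP v]; rewrite /= eqxx ?orbT.
by apply/implyP => /pred2P[] ->.
Qed.

(** * Polynomials of n-vertex graphs; isolated vertices, pendant vertices and cones *)

(** Any vertex type of size [n] is allowed, so that [option T] can be used without relabelling;
    [realizes_values] transports the result to ['I_n]. *)
Definition realizes (R : realType) (n : nat) (P : {poly R}) : Prop :=
  exists (T : finType) (e : rel T),
    [/\ #|T| = n, simple_graph e & is_chromatic_poly e P].

Lemma realizes_values (R : realType) n (P : {poly R}) (q : R) :
  realizes n P -> chromatic_values n q P.[q].
Proof.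
move=> [T [e [cT [eS eI] eP]]].
move: cT eP => <- {n} eP.
pose e' : rel 'I_#|T| := fun i j => e (enum_val i) (enum_val j).
exists e'; split; first by split=> [i j|i]; [exact: eS|exact: eI].
congr (_.[q]); apply: (chromatic_poly_unique (e := e')); last first.
  exact: chromatic_polyP.
move=> k; rewrite eP; congr (_%:R).
pose h (f : {ffun T -> 'I_k}) : {ffun 'I_#|T| -> 'I_k} :=
  [ffun i => f (enum_val i)].
have h_inj : injective h.
  move=> f g /ffunP fg; apply/ffunP => x.
  by have := fg (enum_rank x); rewrite !ffunE enum_rankK.
rewrite /colour_count -(card_imset _ h_inj); apply: eq_card => f.
rewrite inE; apply/imsetP/idP => [[g + ->]|/forallP fP].
  rewrite inE => /forallP gP; apply/forallP => i; apply/forallP => j.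
  by rewrite !ffunE; have /forallP := gP (enum_val i); exact.
exists [ffun x => f (enum_rank x)].
  rewrite inE; apply/forallP => x; apply/forallP => y.
  have /forallP/(_ (enum_rank y)) := fP (enum_rank x).
  by rewrite /e' !enum_rankK !ffunE.
by apply/ffunP => i; rewrite !ffunE enum_valK.
Qed.

Lemma values_realizes (R : realType) n (v q : R) :
  chromatic_values n q v -> exists2 P : {poly R}, realizes n P & v = P.[q].
Proof.
move=> [e [eG ->]]; exists (chromatic_poly R e) => //.
by exists 'I_n, e; split; rewrite ?card_ord //; exact: chromatic_polyP.
Qed.

Lemma realizes_isolated (R : realType) n (P : {poly R}) :
  realizes n P -> realizes n.+1 ('X * P).
Proof.
move=> [T [e [cT eG eP]]]; exists (option T), (adjoin e pred0); split.
- by rewrite card_option cT.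
- exact: simple_adjoin.
move=> k; rewrite hornerM hornerX eP -natrM; congr (_%:R).
rewrite colour_count_adjoin /colour_count.
transitivity (\sum_(g : {ffun T -> 'I_k} | proper_colouring e g) k)%N.
  rewrite sum_nat_const mulnC; congr (_ * _)%N.
  by apply: eq_card => f; rewrite !inE.
apply: eq_bigr => g _; rewrite -[LHS]card_ord -cardsT; apply: eq_card => c.
by rewrite !inE; apply/esym/forallP.
Qed.

Lemma realizes_pendant (R : realType) n (P : {poly R}) :
  (0 < n)%N -> realizes n P -> realizes n.+1 (('X - 1) * P).
Proof.
move=> n_gt0 [T [e [cT eG eP]]].
have /card_gt0P[u _] : (0 < #|T|)%N by rewrite cT.
exists (option T), (adjoin e (pred1 u)); split.
- by rewrite card_option cT.
- exact: simple_adjoin.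
move=> k; rewrite hornerM eP !hornerE colour_count_adjoin natr_sum.
rewrite (eq_bigr (fun=> k%:R - 1)) => [|g _].
  rewrite sumr_const -[RHS]mulr_natr; congr (_ * _%:R).
  by apply: eq_card => f; rewrite !inE.
rewrite -(card_neq1 R (g u)); congr (_%:R); apply: eq_card => c.
by rewrite !inE forall_pred1.
Qed.

(** Once the apex has colour [c], the other vertices are properly coloured with the remaining
    colours, which [lift c] identifies with ['I_k]. *)
Lemma realizes_cone (R : realType) n (P : {poly R}) :
  realizes n P -> realizes n.+1 ('X * (P \Po ('X - 1))).
Proof.
move=> [T [e [cT eG eP]]]; exists (option T), (adjoin e predT); split.
- by rewrite card_option cT.
- exact: simple_adjoin.
(* With no colours, [k - 1] is not a number of colours; both sides are 0 because the apex cannot be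
   coloured. *)
case=> [|k].
  rewrite hornerM hornerX mul0r /colour_count eq_card0 // => F.
  by case: (F None).
rewrite hornerM hornerX horner_comp !hornerE.
rewrite -natr1 addrK eP natr1 -natrM; congr (_%:R).
rewrite colour_count_adjoin.
under eq_bigr do rewrite -sum1_card.
(* Summing over the apex colour first leaves [k.+1] equal terms. *)
rewrite (exchange_big_dep predT) //=.
transitivity (\sum_(c : 'I_k.+1) colour_count e k)%N.
  by rewrite sum_nat_const card_ord.
apply: eq_bigr => c _; rewrite sum1_card /colour_count.
pose h (f : {ffun T -> 'I_k}) : {ffun T -> 'I_k.+1} := [ffun x => lift c (f x)].
have h_inj : injective h.
  move=> f g /ffunP fg; apply/ffunP => x.
  by have := fg x; rewrite !ffunE => /lift_inj.
rewrite -(card_imset _ h_inj); apply: eq_card => f.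
rewrite [RHS]unfold_in /= inE; apply/imsetP/andP.
  move=> [g + ->]; rewrite inE => /forallP gP; split.
    apply/forallP => x; apply/forallP => y.
    by rewrite !ffunE (inj_eq lift_inj); have /forallP := gP x.
  by apply/forallP => x; rewrite ffunE eq_sym neq_lift.
move=> [/forallP fP /forallP fc].
have fl x : {i | f x = lift c i}.
  by have := fc x; rewrite eq_sym => /unlift_some[i -> _]; exists i.
exists [ffun x => sval (fl x)].
  rewrite inE; apply/forallP => x; apply/forallP => y.
  rewrite !ffunE -(inj_eq (@lift_inj _ c)) -(svalP (fl x)) -(svalP (fl y)).
  by have /forallP := fP x.
by apply/ffunP => x; rewrite !ffunE -(svalP (fl x)).
Qed.

(** * Graphs with two marked vertices and the series and parallel steps *)

(* The first conjunct replaces the contraction G / uv, whose chromatic polynomial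
   is A. *)
Definition terminal_graph (R : realType) (n : nat) (A B : {poly R}) : Prop :=
  realizes n A /\
  exists (T : finType) (e : rel T) (u v : T),
    [/\ #|T| = n.+1, simple_graph e, u != v,
        forall k, A.[k%:R] = #|[set f : {ffun T -> 'I_k} |
          proper_colouring e f && (f u == f v)]%SET|%:R
      & forall k, B.[k%:R] = #|[set f : {ffun T -> 'I_k} |
          proper_colouring e f && (f u != f v)]%SET|%:R].

(** Adding the edge [uv] imposes exactly the condition [f u != f v]. *)
Lemma terminal_graph_realizes (R : realType) n (A B : {poly R}) :
  terminal_graph n A B -> realizes n.+1 B.
Proof.
move=> [_ [T [e [u [v [cT [eS eI] uv _ BE]]]]]].
pose e' : rel T := fun x y =>
  e x y || ((x == u) && (y == v) || (x == v) && (y == u)).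
exists T, e'; split=> //.
  split=> [x y|x]; rewrite /e'.
    by rewrite eS; congr (_ || _); rewrite orbC andbC [X in _ || X]andbC.
  rewrite eI andbC orbb; apply/negP => /andP[/eqP xv /eqP xu].
  by rewrite -xu -xv eqxx in uv.
move=> k; rewrite BE; congr (_%:R); apply: eq_card => f; rewrite !inE.
apply/andP/forallP => [[/forallP fP fuv] x|fP].
  apply/forallP => y; apply/implyP => /orP[exy|].
    by have /forallP/(_ y)/implyP := fP x; exact.
  by move=> /orP[] /andP[/eqP -> /eqP ->] //; rewrite eq_sym.
split.
  apply/forallP => x; apply/forallP => y; apply/implyP => exy.
  by have /forallP/(_ y) := fP x; rewrite /e' exy.
by have /forallP/(_ v) := fP u; rewrite /e' !eqxx orbT.
Qed.

(** The graph is two isolated vertices, both marked. *)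
Lemma terminal_graph_base (R : realType) :
  terminal_graph 1 ('X : {poly R}) ('X * ('X - 1)).
Proof.
have base : realizes 1 ('X : {poly R}).
  exists unit, (fun _ _ => false); split; [exact: card_unit| by [] |].
  move=> k; rewrite hornerX; congr (_%:R).
  have -> : colour_count (fun _ _ : unit => false) k =
            #|{: {ffun unit -> 'I_k}}|.
    by apply: eq_card => f; rewrite !inE; apply/forallP => x; apply/forallP.
  by rewrite card_ffun card_ord card_unit expn1.
split=> //.
exists (option unit), (adjoin (fun _ _ => false) pred0), None, (Some tt).
have all0 k (g : {ffun unit -> 'I_k}) c :
  [forall x, pred0 x ==> (g x != c)] by apply/forallP.
have tP k (g : {ffun unit -> 'I_k}) :
  proper_colouring (fun _ _ => false) g by apply/forallP => x; apply/forallP.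
split=> //; first by rewrite card_option card_unit.
- exact: simple_adjoin.
- move=> k; rewrite hornerX card_adjoin natr_sum.
  rewrite (eq_bigr (fun=> 1)) => [|g _].
    rewrite sumr_const (eq_card (B := {: {ffun unit -> 'I_k}})) => [|g].
      by rewrite card_ffun card_ord card_unit expn1.
    by transitivity true; first exact: tP.
  rewrite (_ : [set _ | _]%SET = [set g tt]%SET) ?cards1 //.
  by apply/setP => c; rewrite !inE all0 !ffunE.
move=> k; rewrite !hornerE card_adjoin natr_sum.
rewrite (eq_bigr (fun=> k%:R - 1)) => [|g _].
  rewrite sumr_const (eq_card (B := {: {ffun unit -> 'I_k}})) => [|g].
    by rewrite card_ffun card_ord card_unit expn1 -[RHS]mulr_natl.
  by transitivity true; first exact: tP.
rewrite -(card_neq1 R (g tt)); congr (_%:R); apply: eq_card => c.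
by rewrite !inE all0 !ffunE /= eq_sym.
Qed.

Lemma sum_proper_if (R : realType) (T C : finType) (e : rel T)
    (b : pred {ffun T -> C}) (x y : R) :
  \sum_(g | proper_colouring e g) (if b g then x else y) =
  x * #|[set g | proper_colouring e g && b g]%SET|%:R +
  y * #|[set g | proper_colouring e g && ~~ b g]%SET|%:R.
Proof.
rewrite (bigID b) /=; congr (_ + _).
  rewrite (eq_bigr (fun=> x)) => [|g /andP[_ ->]] //.
  rewrite sumr_const -[LHS]mulr_natr; congr (_ * _%:R).
  by apply: eq_card => g; rewrite !inE.
rewrite (eq_bigr (fun=> y)) => [|g /andP[_ /negPf ->]] //.
rewrite sumr_const -[LHS]mulr_natr; congr (_ * _%:R).
by apply: eq_card => g; rewrite !inE.
Qed.

(** The new vertex is joined to both [u] and [v], which stay marked. It avoids one colour if they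
    agree and two if not. In the contraction it becomes a pendant vertex, whence the first
    conjunct. *)
Lemma terminal_graph_parallel (R : realType) n (A B : {poly R}) :
  (0 < n)%N -> terminal_graph n A B ->
  terminal_graph n.+1 (('X - 1) * A) (('X - 2%:P) * B).
Proof.
move=> n_gt0 [An [T [e [u [v [cT eG uv AE BE]]]]]].
split; first exact: realizes_pendant.
exists (option T), (adjoin e (pred2 u v)), (Some u), (Some v); split => //.
- by rewrite card_option cT.
- exact: simple_adjoin.
- move=> k; rewrite hornerM AE !hornerE card_adjoin natr_sum.
  rewrite (eq_bigr (fun g : {ffun T -> 'I_k} =>
    if g u == g v then k%:R - 1 else 0)) => [|g _].
    by rewrite (sum_proper_if _ (fun g => g u == g v)) mul0r addr0.
  case: eqVneq => [guv|guv].
    rewrite -(card_neq1 R (g u)); congr (_%:R); apply: eq_card => c.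
    by rewrite !inE forall_pred2 !ffunE /= guv eqxx andbT andbb.
  by rewrite eq_card0 // => c; rewrite !inE !ffunE /= (negPf guv) andbF.
move=> k; rewrite hornerM BE !hornerE card_adjoin natr_sum.
rewrite (eq_bigr (fun g : {ffun T -> 'I_k} =>
  if g u == g v then 0 else k%:R - 2)) => [|g _].
  by rewrite (sum_proper_if _ (fun g => g u == g v)) mul0r add0r.
case: eqVneq => [guv|guv].
  by rewrite eq_card0 // => c; rewrite !inE !ffunE /= guv eqxx andbF.
rewrite -(card_neq2 R guv); congr (_%:R); apply: eq_card => c.
by rewrite !inE forall_pred2 !ffunE /= guv andbT.
Qed.

(** The new vertex hangs at [u] and replaces it as a marked vertex. It can share the colour of [v]
    exactly when [u] and [v] differ, so the new contraction is the old graph with the edge [uv]. To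
    differ from [v], it avoids one or two colours according to whether [u] and [v] agree. *)
Lemma terminal_graph_series (R : realType) n (A B : {poly R}) :
  terminal_graph n A B ->
  terminal_graph n.+1 B (('X - 1) * A + ('X - 2%:P) * B).
Proof.
move=> tAB; split; first exact: terminal_graph_realizes tAB.
move: tAB => [An [T [e [u [v [cT eG uv AE BE]]]]]].
exists (option T), (adjoin e (pred1 u)), None, (Some v); split => //.
- by rewrite card_option cT.
- exact: simple_adjoin.
- move=> k; rewrite BE card_adjoin natr_sum.
  rewrite (eq_bigr (fun g : {ffun T -> 'I_k} =>
    if g u == g v then 0 else 1)) => [|g _].
    by rewrite (sum_proper_if _ (fun g => g u == g v)) mul0r mul1r add0r.
  case: eqVneq => [guv|guv].
    rewrite eq_card0 // => c; rewrite !inE forall_pred1 !ffunE /= guv eq_sym.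
    by case: eqP.
  rewrite (_ : [set _ | _]%SET = [set g v]%SET) ?cards1 //.
  apply/setP => c; rewrite !inE forall_pred1 !ffunE /=.
  by case: (eqVneq c (g v)) => [->|_]; rewrite ?guv ?andbF.
move=> k; rewrite hornerD !hornerM AE BE !hornerE card_adjoin natr_sum.
rewrite (eq_bigr (fun g : {ffun T -> 'I_k} =>
  if g u == g v then k%:R - 1 else k%:R - 2)) => [|g _].
  by rewrite (sum_proper_if _ (fun g => g u == g v)).
case: eqVneq => [guv|guv].
  rewrite -(card_neq1 R (g u)); congr (_%:R); apply: eq_card => c.
  by rewrite !inE forall_pred1 !ffunE /= -guv [c == _]eq_sym andbb.
rewrite -(card_neq2 R guv); congr (_%:R); apply: eq_card => c.
by rewrite !inE forall_pred1 !ffunE /= [c == _]eq_sym.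
Qed.

(** * The two maps on ratios *)

(* The values of [- A.[q] / B.[q]] for [p = 1 - q]: [true] stands for
   [terminal_graph_series] and [false] for [terminal_graph_parallel]. *)
Fixpoint ratio (R : realType) (p : R) (w : seq bool) : R :=
  match w with
  | [::] => (1 + p)^-1
  | b :: w' => if b then (1 + p - p * ratio p w')^-1
               else p * ratio p w' / (1 + p)
  end.

(** For s in (0, 1], [1 + p - p * s] lies in [1, 1 + p) and [p * s] in (0, p], so both maps preserve
    (0, 1]. *)
Lemma ratio_itv (R : realType) (p : R) (w : seq bool) :
  0 < p < 1 -> 0 < ratio p w <= 1.
Proof.
move=> /andP[p0 p1]; elim: w => [|[] w /andP[s0 s1]] /=.
- by rewrite invr_gt0 invf_le1; lra.
- by rewrite invr_gt0 invf_le1; nra.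
- by rewrite divr_gt0 ?ler_pdivrMr ?mulr_gt0; nra.
Qed.

(* Ping-pong: the image of (0, 1] under one map lies above 1 / (1 + p), and
   under the other map below it. *)
Lemma ratio_inj (R : realType) (p : R) (w w' : seq bool) :
  0 < p < 1 -> size w = size w' -> ratio p w = ratio p w' -> w = w'.
Proof.
move=> p01; have /andP[p0 p1] := p01.
have above v : (1 + p)^-1 < (1 + p - p * ratio p v)^-1.
  by have /andP[s0 s1] := ratio_itv v p01; rewrite ltf_pV2 ?posrE; nra.
have below v : p * ratio p v / (1 + p) < (1 + p)^-1.
  have /andP[s0 s1] := ratio_itv v p01.
  by rewrite ltr_pdivrMr ?mulVf; nra.
elim: w w' => [|b w IHw] [|b' w'] //= [ww'].
case: b b' => [] [] E.
- move/invr_inj: E => /addrI/oppr_inj/(mulfI (lt0r_neq0 p0)) E.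
  by rewrite (IHw w').
- by have := lt_trans (below w') (above w); rewrite E ltxx.
- by have := lt_trans (below w) (above w'); rewrite E ltxx.
- have p1_neq0 : (1 + p)^-1 != 0 by rewrite invr_neq0 //; lra.
  by move/(mulIf p1_neq0)/(mulfI (lt0r_neq0 p0)): E => E; rewrite (IHw w').
Qed.

(** With p = 1 - q, the factors x - 1 and x - 2 of the two steps take the values -p and -(1 + p) at
    q. *)
Lemma ratio_terminal_graph (R : realType) (q : R) (w : seq bool) : 0 < q < 1 ->
  exists A B : {poly R}, [/\ terminal_graph (size w).+2 A B, B.[q] != 0
    & ratio (1 - q) w = - A.[q] / B.[q]].
Proof.
move=> /andP[q0 q1]; have p01 : 0 < 1 - q < 1 by lra.
have X1 : ('X - 1 : {poly R}).[q] = q - 1 by rewrite !hornerE.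
have hE := (X1, @hornerXsubC R, @hornerX R, @hornerM R, @hornerD R).
have q_neq0 : q != 0 by lra.
have q1_neq0 : q - 1 != 0 by lra.
have q2_neq0 : q - 2 != 0 by lra.
have r2_neq0 : 1 + (1 - q) != 0 by lra.
elim: w => [|b w [A [B [tAB B_neq0 sE]]]] /=.
  (* Two isolated vertices have ratio 1 / p > 1, outside (0, 1]; one parallel step brings it to 1 /
     (1 + p). *)
  have := terminal_graph_parallel (ltn0Sn 0) (terminal_graph_base R).
  set A := (X in terminal_graph _ X _); set B := (X in terminal_graph _ _ X).
  move=> tAB; exists A, B; split=> //; rewrite /A /B !hE.
    by rewrite !mulf_neq0.
  by field; rewrite q_neq0 q1_neq0 q2_neq0 r2_neq0.
have /andP[s0 s1] := ratio_itv w p01.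
have AE : A.[q] = - ratio (1 - q) w * B.[q] by rewrite sE; field.
case: b.
  (* The new B is -D times the old one at q, and D is at least 1 since the ratio is at most 1. *)
  have D_neq0 : 1 + (1 - q) - (1 - q) * ratio (1 - q) w != 0.
    by apply: lt0r_neq0; nra.
  have DE : (q - 1) * A.[q] + (q - 2) * B.[q] =
            - (1 + (1 - q) - (1 - q) * ratio (1 - q) w) * B.[q].
    by rewrite AE; ring.
  exists B, (('X - 1) * A + ('X - 2%:P) * B); split.
  - exact: terminal_graph_series.
  - by rewrite !hE DE mulf_neq0 ?oppr_eq0.
  - by rewrite !hE DE mulNr invrN mulrNN invfM mulrCA mulfV ?mulr1.
exists (('X - 1) * A), (('X - 2%:P) * B); split.
- exact: terminal_graph_parallel.
- by rewrite !hE mulf_neq0.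
- by rewrite !hE sE; field; rewrite B_neq0 q2_neq0 r2_neq0.
Qed.

(** * Counting values *)

Lemma card_chromatic_values_scale (R : realType) m n (q r c : R) : c != 0 ->
  (forall v, chromatic_values m q v -> chromatic_values n r (c * v)) ->
  (#|` fset_set (chromatic_values m q)| <=
   #|` fset_set (chromatic_values n r)|)%N.
Proof.
move=> c_neq0 sub; rewrite -(size_map ( *%R c)); apply: uniq_leq_size.
  by rewrite map_inj_uniq ?fset_uniq //; exact: mulfI.
move=> _ /mapP[v + ->].
rewrite !in_fset_set; try exact: finite_chromatic_values.
by rewrite !inE => /sub.
Qed.

Lemma card_chromatic_valuesS (R : realType) n (q : R) : q != 0 ->
  (#|` fset_set (chromatic_values n q)| <=
   #|` fset_set (chromatic_values n.+1 q)|)%N.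
Proof.
move=> q0; apply: (card_chromatic_values_scale q0) => v.
move=> /values_realizes[P /realizes_isolated nP ->].
by have := realizes_values q nP; rewrite hornerM hornerX.
Qed.

(** Each cone raises the evaluation point by 1 and multiplies the value by the new point, which is
    positive. *)
Lemma card_chromatic_values_cone (R : realType) n k (q : R) : 0 < q ->
  (#|` fset_set (chromatic_values n q)| <=
   #|` fset_set (chromatic_values (n + k) (q + k%:R))|)%N.
Proof.
move=> q0; elim: k => [|k IHk]; first by rewrite addn0 addr0.
apply: leq_trans IHk _; rewrite addnS -natr1 addrA.
have qk_neq0 : q + k%:R + 1 != 0.
  by rewrite lt0r_neq0 // ltr_wpDr // ltr_wpDr.
apply: (card_chromatic_values_scale qk_neq0) => v.
move=> /values_realizes[P /realizes_cone nP ->].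
have := realizes_values (q + k%:R + 1) nP.
by rewrite hornerM hornerX horner_comp !hornerE addrK.
Qed.

Lemma card_chromatic_values_lt1 (R : realType) l (q : R) : 0 < q < 1 ->
  (2 ^ l <= #|` fset_set (chromatic_values l.+3 q)| ^ 2)%N.
Proof.
move=> q01; have /andP[q0 q1] := q01.
have p01 : 0 < 1 - q < 1 by lra.
have q_neq0 : q != 0 by lra.
rewrite (leq_trans _ (leq_mul (card_chromatic_valuesS _ q_neq0) (leqnn _))) //.
set V := fset_set (chromatic_values l.+2 q).
set V' := fset_set (chromatic_values l.+3 q).
pose W := [seq ratio (1 - q) (val w) | w <- enum {: l.-tuple bool}].
have -> : (2 ^ l)%N = size W.
  by rewrite size_map -cardE card_tuple card_bool.
(* [allpairs] keeps repetitions, so its length is the full product; only [W] has to be free of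
   duplicates. *)
rewrite -(size_allpairs (fun a b => - a / b) V V').
apply: uniq_leq_size.
  rewrite map_inj_uniq ?enum_uniq // => w w' /(ratio_inj p01) ww'.
  by apply/val_inj/ww'; rewrite !size_tuple.
move=> _ /mapP[w _ ->].
have [A [B [tAB B_neq0 ->]]] := ratio_terminal_graph (val w) q01.
rewrite size_tuple in tAB.
apply/allpairsP; exists (A.[q], B.[q]); split=> //=.
- rewrite in_fset_set ?inE; last exact: finite_chromatic_values.
  by apply: realizes_values; case: tAB.
- rewrite in_fset_set ?inE; last exact: finite_chromatic_values.
  exact: realizes_values (terminal_graph_realizes tAB).
Qed.

Theorem theorem1p2 (R : realType) (q : R) (n : nat) (hq0 : 0 < q)
    (hqint : q \isn't a Num.int) (hn : Num.ceil q + 2 <= n%:Z) :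
  2 `^ ((n%:R - (Num.ceil q)%:~R - 2) / 2)
    <= (#|` fset_set (chromatic_values n q)|%:R : R).
Proof.
have /andP[qlb _] := ceil_itv q.
(* Strictness, from [q] not being an integer, gives q - k < 1 when the ceiling is k + 1. *)
have qlt : q < (Num.ceil q)%:~R.
  have /andP[_] := ceil_itv q; rewrite le_eqVlt => /orP[/eqP qE|//].
  by rewrite intrEceil -qE eqxx in hqint.
have : 0 < Num.ceil q by rewrite -(ltr0z R) (lt_trans hq0).
move: qlb qlt hn; case: (Num.ceil q) => // -[//|k].
have kE : (k.+1%:Z)%:~R = k%:R + 1 :> R by rewrite -pmulrn natr1.
rewrite rmorphB /= kE addrK => qlb qlt hn _.
have {hn} : (k.+1 + 2 <= n)%N := hn.
(* Here n = (l + 3) + k: the bound for l + 3 vertices at q - k, followed by k cones. *)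
rewrite addn2 => /subnK <-; set l := (n - k.+3)%N.
have q01 : 0 < q - k%:R < 1 by lra.
have := card_chromatic_values_lt1 l q01.
have /andP[q0 _] := q01.
have := card_chromatic_values_cone l.+3 k q0.
rewrite subrK addSnnS addSnnS addSnnS -leq_sqr => le1 /leq_trans/(_ le1) le2.
have -> : (l + k.+3)%:R - (k%:R + 1) - 2 = l%:R :> R.
  by rewrite natrD -addn3 natrD; ring.
(* Squaring turns the real power with exponent l / 2 into [2 ^+ l], matching the bound on
   naturals. *)
rewrite -(@ler_pXn2r _ 2) ?nnegrE ?powR_ge0 //.
have -> : (2 `^ (l%:R / 2)) ^+ 2 = 2 ^+ l :> R.
  by rewrite -powR_mulrn ?powR_ge0 // -powRrM divfK ?pnatr_eq0 // powR_mulrn.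
by rewrite -!natrX ler_nat.
Qed.
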